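(* Let $(A,\mu,\alpha)$ be a Hom-alternative algebra. Then $(\mathrm{Ker}(\alpha),\mu,\alpha)$ is a two-sided Hom-ideal of $(A,\mu,\alpha)$.
   Context: All vector spaces are over a fixed field $\mathbb{K}$ of characteristic $0$. A Hom-algebra is a triple $(A,\mu,\alpha)$ with $A$ a vector space, $\mu:A\otimes A\to A$ linear and $\alpha:A\to A$ linear; it is multiplicative if $\alpha\circ\mu=\mu\circ(\alpha\otimes\alpha)$. Its Hom-associator is $as_A(x,y,z)=\mu(\mu(x,y),\alpha(z))-\mu(\alpha(x),\mu(y,z))$. A Hom-alternative algebra is a multiplicative Hom-algebra with $as_A(x,x,y)=0$ and $as_A(x,y,y)=0$ for all $x,y\in A$. A two-sided Hom-ideal of $(A,\mu,\alpha)$ is a linear subspace $H\subseteq A$ such that $\alpha(H)\subseteq H$ and $\mu(a,b),\mu(b,a)\in H$ for all $a\in A$, $b\in H$. *)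

(* Defs.v *)
From HB Require Import structures.
From mathcomp Require Import all_boot all_order all_algebra.

Set Implicit Arguments.
Unset Strict Implicit.
Unset Printing Implicit Defensive.

Import GRing.Theory.

Local Open Scope ring_scope.

(* A Hom-algebra (A, mu, alpha) is given by its three components: a (possibly
   infinite-dimensional) K-vector space A, a bilinear map mu standing for the
   linear map on the tensor square of A, and a linear map alpha. *)
Section HomAlgebra.

Variables (K : fieldType) (A : lmodType K).
Variables (mu : {bilinear A -> A -> A}) (alpha : {linear A -> A}).

Definition hom_multiplicative : Prop := {morph alpha : x y / mu x y}.

Definition hom_associator (x y z : A) : A :=
  mu (mu x y) (alpha z) - mu (alpha x) (mu y z).

Definition hom_alternative : Prop :=
  [/\ hom_multiplicative,
      forall x y : A, hom_associator x x y = 0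
    & forall x y : A, hom_associator x y y = 0].

Definition hom_ideal (H : {pred A}) : Prop :=
  [/\ submod_closed H,
      forall b : A, b \in H -> alpha b \in H
    & forall a b : A, b \in H -> mu a b \in H /\ mu b a \in H].

End HomAlgebra.

Definition ker (K : fieldType) (A B : lmodType K) (f : {linear A -> B}) :
    {pred A} :=
  [pred x | f x == 0].

(* Main.v *)
Require Import Defs.
From HB Require Import structures.
From mathcomp Require Import all_boot all_order all_algebra.

Set Implicit Arguments.
Unset Strict Implicit.
Unset Printing Implicit Defensive.

Import GRing.Theory.

Local Open Scope ring_scope.

(** Multiplicativity makes [alpha] an endomorphism of the algebra [(A, mu)], and
    the kernel of an algebra morphism absorbs products on both sides: if
    [alpha b = 0], then [alpha (mu a b) = mu (alpha a) 0 = 0], and symmetrically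
    for [mu b a]. Stability under the twisting map itself holds because [alpha]
    sends the kernel to [0]. *)

Lemma ker_submod_closed (K : fieldType) (A B : lmodType K)
    (f : {linear A -> B}) : submod_closed (ker f).
Proof.
split=> [|k x y]; rewrite !inE ?linear0 // => /eqP fx0 /eqP fy0.
by rewrite linearP fx0 fy0 scaler0 addr0.
Qed.

Lemma hom_multiplicative_ker_ideal (K : fieldType) (A : lmodType K)
    (mu : {bilinear A -> A -> A}) (alpha : {linear A -> A}) :
  hom_multiplicative mu alpha -> hom_ideal mu alpha (ker alpha).
Proof.
move=> alphaM; split; first exact: ker_submod_closed.
  by move=> b; rewrite !inE => /eqP ->; rewrite linear0.
move=> a b; rewrite !inE => /eqP alphab0.
by rewrite !alphaM alphab0 linear0r linear0l.
Qed.

Theorem lemma3p8 (K : fieldType) (charK0 : [pchar K] =i pred0)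
    (A : lmodType K) (mu : {bilinear A -> A -> A}) (alpha : {linear A -> A}) :
  hom_alternative mu alpha -> hom_ideal mu alpha (ker alpha).
Proof. by case=> alphaM _ _; exact: hom_multiplicative_ker_ideal. Qed.
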